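(* Let $f=\sum_{i=0}^n a_ix^i\in\mathbb{Z}[x]$ with $n>0$, $a_n>0$, $a_0\neq0$ and $\gcd(a_0,\dots,a_n)=1$. If $f\in\Phi_1\setminus\Phi_0$ has a unique positive real root $x_+$, then $x_+\geq1$.
   Context: For $h\in\mathbb{Z}[x]$, $\mathrm{lt}(h)$ is the leading term and $h^+,h^-\in\mathbb{N}[x]$ are the positive and negative parts, $h=h^+-h^-$ with no monomial occurring in both. $\Phi_0=\{h\in\mathbb{Z}[x]\mid \mathrm{lt}(h)=h^+\}$ and $\Phi_1=\{h\in\mathbb{Z}[x]\mid hg\in\Phi_0\text{ for some monic }g\in\mathbb{Z}[x]\}$. *)

(* Defs.v *)
From mathcomp Require Import all_boot all_order all_algebra.

Set Implicit Arguments.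
Unset Strict Implicit.
Unset Printing Implicit Defensive.

Import Order.TTheory GRing.Theory Num.Theory.

Local Open Scope ring_scope.

(* With this convention [lead_term 0 = 0]. *)
Definition lead_term (h : {poly int}) : {poly int} :=
  lead_coef h *: 'X^((size h).-1).

(* h^+ and h^- are elements of N[x], viewed here inside Z[x]; the lemmas below
   are their characterization. *)
Definition pos_part (h : {poly int}) : {poly int} :=
  \poly_(i < size h) Num.max h`_i 0.

Definition neg_part (h : {poly int}) : {poly int} :=
  \poly_(i < size h) Num.max (- h`_i) 0.

Lemma coef_pos_part (h : {poly int}) (i : nat) :
  (pos_part h)`_i = Num.max h`_i 0.
Proof.
rewrite coef_poly; case: ltnP => // le_hi.
by rewrite nth_default // maxxx.
Qed.

Lemma coef_neg_part (h : {poly int}) (i : nat) :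
  (neg_part h)`_i = Num.max (- h`_i) 0.
Proof.
rewrite coef_poly; case: ltnP => // le_hi.
by rewrite nth_default // oppr0 maxxx.
Qed.

Lemma pos_part_ge0 (h : {poly int}) (i : nat) : 0 <= (pos_part h)`_i.
Proof. by rewrite coef_pos_part le_max lexx orbT. Qed.

Lemma neg_part_ge0 (h : {poly int}) (i : nat) : 0 <= (neg_part h)`_i.
Proof. by rewrite coef_neg_part le_max lexx orbT. Qed.

Lemma pos_partBneg_part (h : {poly int}) : pos_part h - neg_part h = h.
Proof.
apply/polyP => i; rewrite coefB coef_pos_part coef_neg_part.
have [h_le0|h_gt0] := leP h`_i 0.
  by rewrite max_l ?oppr_ge0 // sub0r opprK.
by rewrite max_r ?subr0 // oppr_le0 ltW.
Qed.

Lemma pos_part_neg_part_disjoint (h : {poly int}) (i : nat) :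
  (pos_part h)`_i = 0 \/ (neg_part h)`_i = 0.
Proof.
rewrite coef_pos_part coef_neg_part.
have [h_le0|h_gt0] := leP h`_i 0; [by left | right].
by rewrite max_r // oppr_le0 ltW.
Qed.

Definition Phi0 (h : {poly int}) : Prop := lead_term h = pos_part h.

Definition Phi1 (h : {poly int}) : Prop :=
  exists2 g : {poly int}, g \is monic & Phi0 (h * g).

(* Main.v *)
Require Import Defs.
From mathcomp Require Import all_boot all_order all_algebra all_field.
From mathcomp Require Import reals.

Import Order.TTheory GRing.Theory Num.Theory.

Local Open Scope ring_scope.

(** Write [h = f * g], with [g] monic and, after cancelling a power of ['X],
    [g`_0 != 0].  As [h] lies in [Phi0], [h = c x^m - sum_i b_i x^i] with
    [i < m] and [0 <= b_i].  A root of [h] in ]0, 1[ forces [sum_i b_i < c], so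
    that every complex root of [h], hence of [g], has modulus [< 1].  The product
    of the roots of [g] is the nonzero integer [g`_0] up to sign, so [g] has no
    root at all: [g = 1] and [f] itself lies in [Phi0]. *)

Lemma Phi0_coef (h : {poly int}) (i : nat) :
  Phi0 h -> lead_coef h *+ (i == (size h).-1) = Num.max h`_i 0.
Proof.
by move=> h0; rewrite -coef_pos_part -h0 coefZ coefXn mulr_natr.
Qed.

Lemma Phi0_coef_le0 (h : {poly int}) (i : nat) :
  Phi0 h -> i != (size h).-1 -> h`_i <= 0.
Proof.
move=> /(Phi0_coef _ i) + /negbTE ni.
by rewrite ni mulr0n => e; rewrite [leRHS]e le_max lexx.
Qed.

Lemma Phi0_lead_coef_ge0 (h : {poly int}) : Phi0 h -> 0 <= lead_coef h.
Proof.
move=> /(Phi0_coef _ (size h).-1); rewrite eqxx mulr1n => ->.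
by rewrite le_max lexx orbT.
Qed.

(** Multiplying by ['X^k] only shifts the coefficients. This lets the cofactor of [f] be replaced by
    one with nonzero constant term. *)
Lemma Phi0_mulXn (p : {poly int}) (k : nat) : Phi0 (p * 'X^k) -> Phi0 p.
Proof.
have [-> _|p0 h0] := eqVneq p 0.
  apply/polyP => i; rewrite coef_pos_part /lead_term lead_coef0 scale0r.
  by rewrite !coef0 maxxx.
apply/polyP => i; have := Phi0_coef _ (k + i)%N h0.
rewrite lead_coef_Mmonic ?monicXn // size_mulXn // coefMXn ltnNge leq_addr addKn.
(* The truncated predecessor commutes with the shift by [k] because [p != 0] makes [size p]
   positive. *)
rewrite -[in (k + size p)%N](@prednK (size p)) ?size_poly_gt0 // addnS eqn_add2l.
by rewrite coef_pos_part coefZ coefXn mulr_natr.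
Qed.

(** The ring [F] is generic so as to serve both the real root and the complex ones. *)
Lemma horner_map_intr (F : numDomainType) (h : {poly int}) (m : nat) (z : F) :
  size h = m.+2 ->
  (map_poly intr h).[z] =
    (lead_coef h)%:~R * z ^+ m.+1 - \sum_(i < m.+1) (- h`_i)%:~R * z ^+ i.
Proof.
move=> sh; rewrite (@horner_coef_wide _ m.+2) ?size_poly_leq -?sh ?size_poly //.
rewrite sh big_ord_recr /= coef_map /= lead_coefE sh addrC; congr (_ + _).
rewrite -sumrN; apply: eq_bigr => i _.
by rewrite coef_map /= intrN mulNr opprK.
Qed.

(** With [b_i = - h_i >= 0] and [c] the leading coefficient, [x ^ i >= x ^ m] for [i <= m] gives
    [c x ^ (m+1) >= (sum b_i) x ^ m], so [sum b_i <= c x < c]. *)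
Lemma Phi0_sum_lt_lead_coef (R : numDomainType) (h : {poly int}) (m : nat) (x : R) :
  Phi0 h -> size h = m.+2 -> 0 < x < 1 -> root (map_poly intr h) x ->
  \sum_(i < m.+1) - h`_i < lead_coef h.
Proof.
move=> h0 sh /andP[x0 x1] /eqP; rewrite (horner_map_intr _ _ _ _ sh).
move=> /eqP; rewrite subr_eq0 => /eqP e.
have c0 : 0 < lead_coef h.
  by rewrite lt_def Phi0_lead_coef_ge0 // andbT lead_coef_eq0 -size_poly_gt0 sh.
rewrite -(ltr_int R); apply: (@le_lt_trans _ _ ((lead_coef h)%:~R * x)).
  rewrite -(ler_pM2r (exprn_gt0 m x0)) -mulrA -exprS e rmorph_sum mulr_suml.
  apply: ler_sum => i _; apply: ler_wpM2l.
    by rewrite ler0z oppr_ge0 Phi0_coef_le0 // sh neq_ltn ltn_ord.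
  by apply: ler_wiXn2l; rewrite ?ltW // -ltnS.
by rewrite gtr_pMr // ltr0z.
Qed.

(** The reverse estimate: if [1 <= |z|], then [|z| ^ i <= |z| ^ m], so the triangle inequality
    yields [c |z| <= sum b_i < c], which is absurd. *)
Lemma Phi0_root_norm_lt1 (h : {poly int}) (m : nat) (z : algC) :
  Phi0 h -> size h = m.+2 -> \sum_(i < m.+1) - h`_i < lead_coef h ->
  root (map_poly intr h) z -> `|z| < 1.
Proof.
move=> h0 sh Sc /eqP; rewrite (horner_map_intr _ _ _ _ sh).
move=> /eqP; rewrite subr_eq0 => /eqP e.
(* The order of [algC] is partial, so negating a comparison requires both sides to be real. *)
rewrite real_ltNge ?normr_real ?real1 //; apply/negP => z1.
have z0 : 0 < `|z| by apply: lt_le_trans z1.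
suff : (lead_coef h)%:~R * `|z| <= (\sum_(i < m.+1) - h`_i)%:~R.
  apply/negP; rewrite -real_ltNge ?realz ?realM ?normr_real ?realz //.
  apply: (@lt_le_trans _ _ (lead_coef h)%:~R); first by rewrite ltr_int.
  by rewrite ler_peMr // ler0z Phi0_lead_coef_ge0.
rewrite -(ler_pM2r (exprn_gt0 m z0)) -mulrA -exprS.
have -> : (lead_coef h)%:~R * `|z| ^+ m.+1 = `|(lead_coef h)%:~R * z ^+ m.+1|.
  by rewrite normrM normrX ger0_norm // ler0z Phi0_lead_coef_ge0.
rewrite e rmorph_sum mulr_suml; apply: (le_trans (ler_norm_sum _ _ _)).
apply: ler_sum => i _; have b0 : 0 <= (- h`_i)%:~R :> algC.
  by rewrite ler0z oppr_ge0 Phi0_coef_le0 // sh neq_ltn ltn_ord.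
rewrite normrM normrX ger0_norm //; apply: ler_wpM2l => //.
by apply: ler_weXn2l; rewrite // -ltnS.
Qed.

Lemma monic_roots_lt1_eq1 (g : {poly int}) :
  g \is monic -> g`_0 != 0 ->
  (forall z : algC, root (map_poly intr g) z -> `|z| < 1) -> g = 1.
Proof.
move=> gm g0 rg; pose gC : {poly algC} := map_poly intr g.
have [rs gE] := closed_field_poly_normal gC.
have gCm : gC \is monic by apply: monic_map.
rewrite (monicP gCm) scale1r in gE.
have rs1 z : z \in rs -> `|z| < 1.
  by move=> zrs; apply: rg; rewrite -/gC gE root_prod_XsubC.
have normE : `|(g`_0)%:~R| = \prod_(z <- rs) `|z| :> algC.
  rewrite -coef_map -/gC -horner_coef0 gE horner_prod normr_prod.
  by apply: eq_bigr => z _; rewrite hornerXsubC sub0r normrN.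
have ge1 : 1 <= `|(g`_0)%:~R| :> algC by rewrite norm_intr_ge1 ?intr_eq0.
case: rs => [|z rs] in gE rs1 normE.
  apply: (map_inj_poly (intr_inj : injective (intr : int -> algC))) => //.
  by rewrite rmorph1 -/gC gE big_nil.
suff : `|(g`_0)%:~R| < 1 :> algC by move/(le_lt_trans ge1); rewrite ltxx.
(* One root gives the strict inequality; the other factors only need to be at most 1. *)
rewrite normE big_cons; apply: le_lt_trans (rs1 z (mem_head _ _)).
rewrite ler_piMr // big_seq; apply: prodr_ile1 => y yrs.
by rewrite normr_ge0 ltW // rs1 // inE yrs orbT.
Qed.

Theorem lemma4p12 (R : realType) (n : nat) (a : nat -> int) (f : {poly int})
  (f_def : f = \sum_(i < n.+1) a i *: 'X^i)
  (n_gt0 : (0 < n)%N) (an_gt0 : 0 < a n) (a0_neq0 : a 0%N <> 0)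
  (a_gcd1 : \big[gcdz/0]_(i < n.+1) a i = 1)
  (f_Phi1 : Phi1 f) (f_notPhi0 : ~ Phi0 f)
  (x : R)
  (x_root : 0 < x /\ root (map_poly intr f) x)
  (x_unique : forall y : R, 0 < y /\ root (map_poly intr f) y -> y = x) :
  1 <= x.
Proof.
have fn : f`_n = a n.
  by rewrite f_def -(poly_def n.+1 a) coef_poly ltnSn.
have f0 : f != 0 by apply: contraTneq an_gt0 => f0; rewrite -fn f0 coef0 ltxx.
have [x_gt0 fx] := x_root; rewrite leNgt; apply/negP => x_lt1.
have [g gm fgP] := f_Phi1; apply: f_notPhi0.
(* [k] is the multiplicity of 0 as a root of [g]. *)
have [k [g1 g1_root gE]] := multiplicity_XsubC g 0.
rewrite subr0 in gE; rewrite gE mulrA in fgP.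
have g1m : g1 \is monic by rewrite -(monicMr _ (monicXn _ k)) -gE.
have g10 : g1`_0 != 0.
  by move: g1_root; rewrite monic_neq0 //= /root horner_coef0.
have {fgP} hP := Phi0_mulXn _ _ fgP.
(* The degree is [m + 1], hence positive: [f] has a nonzero coefficient at [n > 0], and a monic
   factor cannot lower the degree. *)
have [m sh] : exists m, size (f * g1) = m.+2.
  have sf : (1 < size f)%N.
    apply: leq_ltn_trans n_gt0 _; rewrite ltnNge; apply: contraTN an_gt0.
    by move=> /leq_sizeP/(_ n (leqnn n)); rewrite fn => ->.
  exists (size (f * g1)).-2; rewrite size_Mmonic //.
  have := monic_neq0 g1m; rewrite -size_poly_gt0.
  by case: (size f) sf => [|[|r]] //; case: (size g1) => // s; rewrite addnS.
have hx : root (map_poly intr (f * g1)) x by rewrite rmorphM rootM fx.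
have Slt : \sum_(i < m.+1) - (f * g1)`_i < lead_coef (f * g1).
  by apply: Phi0_sum_lt_lead_coef hx => //; rewrite x_gt0.
suff g1E : g1 = 1 by rewrite g1E mulr1 in hP.
apply: monic_roots_lt1_eq1 => // z g1z.
by apply: Phi0_root_norm_lt1 hP sh Slt _; rewrite rmorphM rootM g1z orbT.
Qed.
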